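(* Let $n\ge 3$ and $r\ge0$ be integers, put $m=r+1$, and let $p$ be a prime with $p>n$ and $m\mid p-1$. Let $M$ be a multiset of size $n$ with elements in $\Omega=\{a\in\mathbb F_p:a^m=1\}$, and let $\mu_b$ denote the multiplicity of $b$ in $M$. For $a\in\operatorname{supp}(M)$ with $\mu_a\ge2$, let $M'=M'_a$ be the multiset of $n-\mu_a$ entries obtained from $M$ by removing all copies of $a$, and define $$C_a=\frac{(-1)^{\mu_a}m}{a}\prod_{b\in M'}(1-b/a)^{-1},\qquad F_a(s)=e^{-rs}\,\frac{T(s)^{\mu_a}}{T(ms)}\prod_{b\in M'}R_{b/a}(s).$$ Then, for every such $a$, $$\operatorname*{CT}_{u=a^{-1}}E_M(u)=C_a\,[s^{\mu_a-2}]F_a(s),$$ and $$h_r(M)=\sum_{\substack{a\in\operatorname{supp}(M)\\ \mu_a\ge2}}C_a\,[s^{\mu_a-2}]F_a(s)\quad\text{in }\mathbb F_p .$$ The required truncations $F_a(s)\bmod s^{\mu_a-1}$ are well defined modulo every prime $p$ with $p>n$ and $m\mid p-1$.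
   Context: $\operatorname{supp}(M)$ is the set of distinct elements of $M$. Products over a multiset include each entry with its multiplicity. $h_r(x_1,\dots,x_n)=\sum_{\alpha_1+\cdots+\alpha_n=r,\ \alpha_i\ge0}x_1^{\alpha_1}\cdots x_n^{\alpha_n}$, and $h_r(M)$ is its value on the entries of $M$. Put $$E_M(u)=\frac{u^{-r}-u}{\prod_{b\in M}(1-bu)}\in\mathbb F_p(u).$$ For a rational function $E(u)$ and $\alpha\ne0$, if the block of the partial-fraction decomposition of $E$ at $\alpha$ is $A_\alpha(u)/(1-u/\alpha)^{\ell}$ with $\deg A_\alpha<\ell$, then $\operatorname*{CT}_{u=\alpha}E(u):=A_\alpha(0)$; it is $0$ if $E$ is regular at $\alpha$. The series used are $$T(s)=\frac{s}{e^s-1},\qquad R_c(s)=\frac{1-c}{1-ce^s}=\frac1{1-y_c(e^s-1)},\quad y_c=\frac{c}{1-c}\quad(c\ne1).$$ $[s^j]$ denotes the coefficient of $s^j$. All exponential series are used only to the finite order needed (coefficients of $F_a$ of degree at most $\mu_a-2\le n-2$): the required coefficients of $T$ and $e^s$ are rational numbers, reduced modulo $p$; ''well defined'' means that all the coefficients needed to form $F_a(s)\bmod s^{\mu_a-1}$ have denominators invertible in $\mathbb F_p$. *)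

(* Defs.v *)
From HB Require Import structures.
From mathcomp Require Import all_boot all_order all_algebra.
From mathcomp Require Import classical_sets.

Set Implicit Arguments.
Unset Strict Implicit.
Unset Printing Implicit Defensive.

Import GRing.Theory.
Local Open Scope ring_scope.

Local Notation "x %:F" := (@tofrac _ x).

(* A multiset of size n is given by an n-tuple listing its entries (or by a
   seq); everything below is invariant under permutation of the entries. *)

Section Multisets.
Variable R : comNzRingType.

(* Every exponent of a monomial of degree r is at most r, so the exponent
   vectors can be taken in a finite type. *)
Definition hsym (r n : nat) (x : n.-tuple R) : R :=
  \sum_(alpha : {ffun 'I_n -> 'I_r.+1} | (\sum_(i < n) alpha i)%N == r)
    \prod_(i < n) tnth x i ^+ alpha i.

Definition mset_remove (a : R) (M : seq R) : seq R := [seq b <- M | b != a].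

End Multisets.

Section RationalFunctions.
Variable F : fieldType.
Local Notation ratfun := {fraction {poly F}}.

Definition E_fun (r : nat) (M : seq F) : ratfun :=
  let u := 'X%:F in (u ^- r - u) / \prod_(b <- M) (1 - b%:P%:F * u).

(* E = P + \sum_(q <- qs) A q / q ^ (l q), with pairwise coprime irreducible q
   and deg (A q) < l q * deg q; [size] is the degree plus 1. *)
Definition partial_fractions (E : ratfun) (P : {poly F}) (qs : seq {poly F})
    (l : {poly F} -> nat) (A : {poly F} -> {poly F}) : Prop :=
  [/\ {in qs, forall q, irreducible_poly q},
      pairwise (@coprimep F) qs,
      {in qs, forall q, (size (A q) <= l q * (size q).-1)%N}
    & E = P%:F + \sum_(q <- qs) (A q)%:F / (q ^+ l q)%:F].

Definition pole_factor (alpha : F) : {poly F} := 1 - alpha^-1 *: 'X.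

(* A zero block may be listed in a decomposition; in particular the value is 0
   when E is regular at alpha. The value does not depend on the decomposition:
   see CT_block and CT_regular. *)
Definition CT (alpha : F) (E : ratfun) : F :=
  xget 0 (fun c => exists P qs l A,
    [/\ partial_fractions E P qs l A, pole_factor alpha \in qs
      & c = (A (pole_factor alpha)).[0]]).

End RationalFunctions.

(* Formal power series, as sequences of coefficients. *)
Definition fps (R : Type) := nat -> R.

Section PowerSeries.
Variable R : comUnitRingType.
Implicit Types f g : fps R.

Definition fps_one : fps R := fun j => (j == 0)%:R.

Definition fps_mul f g : fps R := fun j => \sum_(i < j.+1) f i * g (j - i)%N.

Definition fps_exp f (k : nat) : fps R := iter k (fps_mul f) fps_one.

(* c * f(s) *)
Definition fps_cmul (c : R) f : fps R := fun j => c * f j.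

(* f(c * s) *)
Definition fps_dilate (c : R) f : fps R := fun j => c ^+ j * f j.

(* For f 0 invertible, 1 / f = (f 0)^-1 * \sum_k (1 - f / f 0) ^ k, where only
   the terms k <= j contribute to the coefficient of s^j; see fps_mulV. *)
Definition fps_inv f : fps R := fun j =>
  (f 0%N)^-1 *
  \sum_(k < j.+1) fps_exp (fun i => fps_one i - (f 0%N)^-1 * f i) k j.

End PowerSeries.

(* e^s and T(s) = s / (e^s - 1) = ((e^s - 1) / s)^-1 over the rationals. *)
Definition exp_rat : fps rat := fun j => (j`!%:R)^-1.
Definition T_rat : fps rat := fps_inv (fun j => exp_rat j.+1).

Section Reduction.
Variable p : nat.

(* ratr x is the numerator of x divided, in 'F_p, by its denominator: it is the
   reduction of x modulo p as soon as [invertible_denom x] holds. *)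
Definition reduce (f : fps rat) : fps 'F_p := fun j => ratr (f j).

Definition invertible_denom (x : rat) : Prop :=
  ((denq x)%:~R : 'F_p) \is a GRing.unit.

Definition invertible_denoms_below (N : nat) (f : fps rat) : Prop :=
  forall j, (j < N)%N -> invertible_denom (f j).

Definition exp_p : fps 'F_p := reduce exp_rat.
Definition T_p : fps 'F_p := reduce T_rat.

(* R_c(s) = (1 - c) / (1 - c * e^s), for c <> 1. *)
Definition R_series (c : 'F_p) : fps 'F_p :=
  fps_cmul (1 - c) (fps_inv (fun j => fps_one _ j - c * exp_p j)).

Variables (r : nat) (M : seq 'F_p) (a : 'F_p).
Let m := r.+1.
Let mu := count_mem a M.
Let M' := mset_remove a M.

Definition C_coef : 'F_p :=
  (-1) ^+ mu * m%:R / a * \prod_(b <- M') (1 - b / a)^-1.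

Definition F_series : fps 'F_p :=
  fps_mul (fps_dilate (- r%:R) exp_p)
    (fps_mul (fps_mul (fps_exp T_p mu) (fps_inv (fps_dilate m%:R T_p)))
       (\big[@fps_mul _/@fps_one _]_(b <- M') R_series (b / a))).

(* All the coefficients entering F_series modulo s^(mu - 1) have invertible
   denominators: those of the rational series e^s, T(s) and of the factors
   e^(-rs), T(s)^mu, 1 / T(ms) built from them, and the divisor 1 - c in
   y_c = c / (1 - c) for each factor R_c. *)
Definition F_well_defined : Prop :=
  let ok := invertible_denoms_below mu.-1 in
  [/\ ok exp_rat /\ ok T_rat,
      ok (fps_dilate (- r%:R) exp_rat),
      ok (fps_exp T_rat mu),
      ok (fps_dilate m%:R T_rat) /\ ok (fps_inv (fps_dilate m%:R T_rat))
    & {in M', forall b, 1 - b / a \is a GRing.unit}].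

End Reduction.

Section PowerSeriesFacts.
Variable R : comUnitRingType.
Implicit Types f g : fps R.

Let trunc N f : {poly R} := \poly_(i < N) f i.

Let coef_mul_trunc N f g (P Q : {poly R}) j : (j < N)%N ->
  (forall i, (i < N)%N -> P`_i = f i) -> (forall i, (i < N)%N -> Q`_i = g i) ->
  (P * Q)`_j = fps_mul f g j.
Proof.
move=> jN hP hQ; rewrite coefM; apply: eq_bigr => i _.
rewrite hP ?hQ //; first exact: leq_ltn_trans (leq_subr _ _) jN.
by apply: leq_trans jN; apply: ltn_ord.
Qed.

Let coef_exp_trunc N f k j : (j < N)%N -> (trunc N f ^+ k)`_j = fps_exp f k j.
Proof.
elim: k j => [|k IHk] j jN; first by rewrite expr0 coef1.
rewrite exprS; apply: (coef_mul_trunc jN) => // i iN.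
by rewrite coef_poly iN.
Qed.

Lemma fps_mulV f : f 0%N \is a GRing.unit -> fps_mul f (fps_inv f) =1 @fps_one R.
Proof.
move=> f0u j; pose N := j.+1.
pose g : fps R := fun i => fps_one R i - (f 0%N)^-1 * f i.
pose G := trunc N g.
have G0 : G`_0 = 0 by rewrite coef_poly /g /fps_one mulVr ?subrr.
have Glow k i : (i < k)%N -> (G ^+ k)`_i = 0.
  elim: k i => // k IHk i ik; rewrite exprS coefM big1 // => -[[|t] /= ti] _.
    by rewrite G0 mul0r.
  rewrite IHk ?mulr0 //; case: i ik ti => // i ik ti.
  by rewrite subSS (leq_ltn_trans (leq_subr _ _)).
have invE i : (i < N)%N ->
    ((f 0%N)^-1 *: \sum_(k < N) G ^+ k)`_i = fps_inv f i.
  move=> iN; rewrite coefZ coef_sum /fps_inv; congr (_ * _).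
  rewrite (big_ord_widen N (fun k => fps_exp g k i)) // [RHS]big_mkcond /=.
  apply: eq_bigr => k _; rewrite coef_exp_trunc //.
  by case: ltnP => // ik; rewrite -(@coef_exp_trunc N) // Glow.
have fE i : (i < N)%N -> (f 0%N *: (1 - G))`_i = f i.
  move=> iN; rewrite coefZ coefB coef1 coef_poly iN /g /fps_one.
  by rewrite opprB addrC subrK mulVKr.
rewrite -(coef_mul_trunc (ltnSn j) fE invE) -scalerAl -scalerAr scalerA.
rewrite divrr // scale1r -[1 - G]opprB mulNr -subrX1 opprB coefB Glow // subr0.
by rewrite coef1.
Qed.

End PowerSeriesFacts.

Section ConstantTermFacts.
Variable F : fieldType.
Local Notation ratfun := {fraction {poly F}}.

Let regular (alpha : F) (E : ratfun) :=
  exists N D : {poly F}, ~~ root D alpha /\ E = N%:F / D%:F.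

Let fracD_eq (N1 D1 N2 D2 : {poly F}) : D1 != 0 -> D2 != 0 ->
  N1%:F / D1%:F + N2%:F / D2%:F = (N1 * D2 + N2 * D1)%:F / (D1 * D2)%:F.
Proof. by move=> D1n D2n; rewrite addf_div ?tofrac_eq0 // -!tofracM -tofracD. Qed.

Let root_neq0 (D : {poly F}) (alpha : F) : ~~ root D alpha -> D != 0.
Proof. by apply: contraNneq => ->; rewrite root0. Qed.

Let regularD (alpha : F) (E1 E2 : ratfun) :
  regular alpha E1 -> regular alpha E2 -> regular alpha (E1 + E2).
Proof.
move=> [N1 [D1 [r1 ->]]] [N2 [D2 [r2 ->]]].
exists (N1 * D2 + N2 * D1), (D1 * D2); split.
  by rewrite rootM negb_or r1.
by rewrite fracD_eq ?(root_neq0 r1) ?(root_neq0 r2).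
Qed.

Let regularN (alpha : F) (E : ratfun) : regular alpha E -> regular alpha (- E).
Proof. by move=> [N [D [rD ->]]]; exists (- N), D; rewrite rmorphN mulNr. Qed.

Variables (alpha : F) (alpha_neq0 : alpha != 0).
Local Notation q0 := (pole_factor alpha).

Let q0E : q0 = (- alpha^-1) *: ('X - alpha%:P).
Proof.
rewrite /pole_factor scaleNr -scalerN opprB scalerBr.
by rewrite -[_ *: _%:P]mul_polyC -polyCM mulVf.
Qed.

Let nalphaV_neq0 : - alpha^-1 != 0.
Proof. by rewrite oppr_eq0 invr_eq0. Qed.

Let size_q0 : size q0 = 2.
Proof. by rewrite q0E size_scale // size_XsubC. Qed.

Let q0_neq0 : q0 != 0.
Proof. by rewrite -size_poly_eq0 size_q0. Qed.

Let q0_coprime (D : {poly F}) : coprimep q0 D = ~~ root D alpha.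
Proof. by rewrite q0E coprimepZl // coprimep_sym coprimep_XsubC. Qed.

Let q0_at0 : q0.[0] = 1.
Proof. by rewrite /pole_factor !hornerE ?mulr0 ?subr0. Qed.

Let block_regular (A : {poly F}) l :
  (size A <= l)%N -> regular alpha (A%:F / (q0 ^+ l)%:F) -> A = 0.
Proof.
move=> sA [N [D [rD /eqP]]].
rewrite eqr_div ?tofrac_eq0 ?expf_neq0 ?(root_neq0 rD) //.
rewrite -!tofracM tofrac_eq => /eqP eAD.
have: q0 ^+ l %| A * D by rewrite eAD dvdp_mull.
rewrite Gauss_dvdpl; last by rewrite coprimep_expl // q0_coprime.
apply: contraTeq => An0; apply/negP => /(dvdp_leq An0).
rewrite q0E exprZn size_scale ?expf_neq0 // size_exp_XsubC => lA.
by have := leq_trans lA sA; rewrite ltnn.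
Qed.

Let q0_exp_at0 l : (q0 ^+ l).[0] = 1.
Proof. by rewrite horner_exp q0_at0 expr1n. Qed.

Let rem_coprime (q : {poly F}) qs :
  pairwise (@coprimep F) qs -> q \in qs -> all (coprimep q) (rem q qs).
Proof.
elim: qs => //= q1 qs IHqs /andP[co1 co]; rewrite inE eq_sym.
case: eqVneq => [<- // | _] /= qqs; rewrite IHqs // andbT coprimep_sym.
exact: (allP co1).
Qed.

Let block_remainder E P qs l A :
  partial_fractions E P qs l A -> q0 \in qs ->
  regular alpha (E - (A q0)%:F / (q0 ^+ l q0)%:F).
Proof.
move=> [_ co _ ->] q0qs.
have regP : regular alpha P%:F.
  by exists P, 1; rewrite root1 tofrac1 divr1.
rewrite (perm_big _ (perm_to_rem q0qs)) big_cons /=.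
rewrite addrCA addrAC subrr add0r; apply: regularD => //.
rewrite big_seq; elim/big_ind: _.
- by exists 0, 1; rewrite root1 tofrac0 mul0r.
- by move=> ? ?; apply: regularD.
- move=> q /(allP (rem_coprime co q0qs)) c.
  by exists (A q), (q ^+ l q); rewrite -q0_coprime coprimep_expr.
Qed.

Let size_block (A : {poly F}) k l :
  (size A <= k)%N -> (size (A * q0 ^+ l)%R <= k + l)%N.
Proof.
move=> sA; rewrite (leq_trans (size_polyMleq _ _)) //.
rewrite q0E exprZn size_scale ?expf_neq0 // size_exp_XsubC addnS /=.
by rewrite leq_add2r.
Qed.

Lemma CT_block E P qs l A :
  partial_fractions E P qs l A -> q0 \in qs -> CT alpha E = (A q0).[0].
Proof.
move=> pfE q0qs; apply: xget_subset1; first by exists P, qs, l, A.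
move=> c1 c2 [P1 [qs1 [l1 [A1 [pf1 q1 ->]]]]] [P2 [qs2 [l2 [A2 [pf2 q2 ->]]]]].
have := regularD (block_remainder pf1 q1) (regularN (block_remainder pf2 q2)).
rewrite opprB addrC addrA subrK.
case: pf1 pf2 => _ _ s1 _ [_ _ s2 _].
move: (s1 _ q1) (s2 _ q2); rewrite size_q0 !muln1 => {}s1 {}s2.
rewrite -mulNr -rmorphN fracD_eq ?expf_neq0 // -exprD => /block_regular A0.
have /(congr1 (fun q => q.[0])) : A2 q0 * q0 ^+ l1 q0 + - A1 q0 * q0 ^+ l2 q0 = 0.
  apply: A0; rewrite (leq_trans (size_polyD _ _)) // geq_max.
  by rewrite [in X in _ && X]addnC !size_block // size_polyN.
rewrite hornerD !hornerM hornerN !q0_exp_at0 !mulr1 horner0 => /eqP.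
by rewrite subr_eq0 => /eqP.
Qed.

Lemma CT_regular (N D : {poly F}) : ~~ root D alpha -> CT alpha (N%:F / D%:F) = 0.
Proof.
move=> rD; rewrite /CT; case: xgetP => // c _ [P [qs [l [A [pf qqs ->]]]]].
have regE : regular alpha (N%:F / D%:F) by exists N, D.
have := regularD regE (regularN (block_remainder pf qqs)).
rewrite opprB addrCA subrr addr0 => /block_regular -> //; first by rewrite horner0.
by case: pf => _ _ /(_ _ qqs) + _; rewrite size_q0 muln1.
Qed.

End ConstantTermFacts.

(* Main.v *)
(* The function E_M has the poles 0 and 1/b (b in M) and vanishes at infinity, so
   it is the sum of its blocks, with no polynomial part. The block at 0 has no
   constant term, hence h_r(M), the constant term of the Laurent expansion of
   E_M at 0, is the sum of the values at 0 of the blocks at the points 1/a.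

   For the block A / (1 - a u)^mu at 1/a, substitute u = e^s / a, with e^s
   truncated modulo s^mu (which makes sense since mu < p). In powers of
   1 - a u = 1 - e^s = - s / T(s), the polynomial A reads
   \sum_(k < mu) c_k (1 - a u)^k with A(0) = \sum_k c_k, and the identity
   [s^j] T(s)^(j+1) = (-1)^j gives
   [s^(mu-1)] T(s)^mu A(e^s / a) = (-1)^(mu-1) A(0).
   On the other hand A is congruent modulo (1 - a u)^mu to the quotient of
   1 - u^m by the product of the other factors of the denominator, and under the
   substitution this quotient times T(s)^mu becomes a multiple of s F_a(s). *)
Require Import Defs.
From HB Require Import structures.
From mathcomp Require Import all_boot all_order all_algebra.
From mathcomp Require Import ring.
Set Implicit Arguments.
Unset Strict Implicit.
Unset Printing Implicit Defensive.

Import GRing.Theory Pdiv.RingMonic.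
Local Open Scope ring_scope.

Local Notation "x %:F" := (@tofrac _ x).

(** * Power series modulo s^(N+1), in the quotient ring F[s]/(s^(N+1)) *)

Section Truncation.
Variables (F : fieldType) (N : nat).
Local Notation Q := {poly %/ ('X^(N.+1) : {poly F})}.
Local Notation pi := (in_qpoly ('X^(N.+1) : {poly F})).
Implicit Types (f g : fps F) (P : {poly F}).

Lemma coef_in_qpoly P j : (j <= N)%N -> (pi P)`_j = P`_j.
Proof.
by move=> jN; rewrite /= mk_monic_Xn /= -take_poly_rmodp coef_take_poly ltnS jN.
Qed.

Lemma eq_in_qpoly P1 P2 :
  (forall j, (j <= N)%N -> P1`_j = P2`_j) -> pi P1 = pi P2.
Proof.
move=> eP; apply: val_inj; rewrite /= mk_monic_Xn /= -!take_poly_rmodp.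
by apply/polyP => j; rewrite !coef_take_poly ltnS; case: ifP => // /eP.
Qed.

Lemma in_qpoly_val (x : Q) : pi x = x.
Proof. by apply: val_inj; apply: in_qpoly_small; apply: size_mk_monic. Qed.

Definition fps_trunc f : Q := pi (\poly_(j < N.+1) f j).

Lemma coef_fps_trunc f j : (j <= N)%N -> (fps_trunc f)`_j = f j.
Proof. by move=> jN; rewrite coef_in_qpoly // coef_poly ltnS jN. Qed.

Lemma qpolyP (x y : Q) : (forall j, (j <= N)%N -> x`_j = y`_j) -> x = y.
Proof.
by move=> exy; rewrite -[x]in_qpoly_val -[y]in_qpoly_val; apply: eq_in_qpoly.
Qed.

Lemma fps_truncP f (x : Q) :
  (forall j, (j <= N)%N -> f j = x`_j) -> fps_trunc f = x.
Proof. by move=> fx; apply: qpolyP => j jN; rewrite coef_fps_trunc // fx. Qed.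

Lemma eq_fps_trunc f g :
  (forall j, (j <= N)%N -> f j = g j) -> fps_trunc f = fps_trunc g.
Proof. by move=> fg; apply: fps_truncP => j jN; rewrite coef_fps_trunc // fg. Qed.

Lemma coef_qpolyM (x y : Q) j : (j <= N)%N ->
  (x * y)`_j = \sum_(i < j.+1) x`_i * y`_(j - i).
Proof.
move=> jN; rewrite -[x in LHS]in_qpoly_val -[y in LHS]in_qpoly_val -rmorphM.
by rewrite coef_in_qpoly // coefM.
Qed.

Lemma fps_truncM f g : fps_trunc (fps_mul f g) = fps_trunc f * fps_trunc g.
Proof.
apply: fps_truncP => j jN; rewrite coef_qpolyM //; apply: eq_bigr => i _.
have ij : (i <= j)%N by rewrite -ltnS.
by rewrite !coef_fps_trunc ?(leq_trans ij) ?(leq_trans (leq_subr _ _)).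
Qed.

Lemma fps_trunc1 : fps_trunc (@fps_one F) = 1.
Proof.
by apply: fps_truncP => j jN; rewrite -(rmorph1 pi) coef_in_qpoly // coef1.
Qed.

Lemma fps_truncX f k : fps_trunc (fps_exp f k) = fps_trunc f ^+ k.
Proof.
elim: k => [|k IHk]; first exact: fps_trunc1.
by rewrite [RHS]exprS -IHk -fps_truncM.
Qed.

Lemma fps_trunc_prod (I : Type) (s : seq I) (f : I -> fps F) :
  fps_trunc (\big[@fps_mul _/@fps_one _]_(i <- s) f i) =
  \prod_(i <- s) fps_trunc (f i).
Proof.
elim: s => [|i s IHs]; first by rewrite !big_nil fps_trunc1.
by rewrite !big_cons fps_truncM IHs.
Qed.

Lemma fps_trunc_mulV f : f 0%N != 0 -> fps_trunc f * fps_trunc (fps_inv f) = 1.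
Proof.
move=> f0; rewrite -fps_truncM -fps_trunc1; apply: eq_fps_trunc => j _.
by rewrite fps_mulV ?unitfE.
Qed.

(** Uniqueness of inverses in the quotient ring avoids comparing the defining sums of [fps_inv] term
    by term. *)
Lemma eq_fps_trunc_inv f g : f 0%N != 0 -> g 0%N != 0 ->
  fps_trunc f = fps_trunc g -> fps_trunc (fps_inv f) = fps_trunc (fps_inv g).
Proof.
move=> f0 g0 fg; rewrite -[LHS]mulr1 -(fps_trunc_mulV g0) -fg mulrCA mulrA.
by rewrite fps_trunc_mulV // mul1r.
Qed.

Lemma coef_qpolyZ c (x : Q) j : (c *: x)`_j = c * x`_j.
Proof. by rewrite poly_of_qpolyZ coefZ. Qed.

Lemma fps_truncZ c f : fps_trunc (fps_cmul c f) = c *: fps_trunc f.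
Proof. by apply: fps_truncP => j jN; rewrite coef_qpolyZ coef_fps_trunc. Qed.

Lemma coef_qpolyXM (x : Q) j : (j <= N)%N ->
  (pi 'X * x)`_j = if j is i.+1 then x`_i else 0.
Proof.
move=> jN; rewrite -[x in LHS]in_qpoly_val -rmorphM coef_in_qpoly // coefXM.
by case: j jN.
Qed.

Lemma coef_qpolyXnM k (x : Q) j : (j <= N)%N ->
  (pi 'X ^+ k * x)`_j = if (j < k)%N then 0 else x`_(j - k).
Proof.
move=> jN; rewrite -[x in LHS]in_qpoly_val -rmorphXn -rmorphM coef_in_qpoly //.
by rewrite coefXnM.
Qed.

Lemma qpolyXn_eq0 : pi 'X ^+ N.+1 = 0.
Proof.
rewrite -rmorphXn -(rmorph0 pi); apply: eq_in_qpoly => j jN.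
by rewrite coefXn coef0 ltn_eqF.
Qed.

(* The Euler operator s * d/ds, which unlike d/ds is defined modulo s^(N+1). *)
Definition theta (x : Q) : Q := pi ('X * (x : {poly F})^`()).

Lemma coef_theta x j : (j <= N)%N -> (theta x)`_j = x`_j *+ j.
Proof. by move=> jN; rewrite coef_in_qpoly // coefXM coef_deriv; case: j jN. Qed.

Lemma thetaM x y : theta (x * y) = theta x * y + x * theta y.
Proof.
apply: qpolyP => j jN; rewrite coef_theta // poly_of_qpolyD coefD !coef_qpolyM //.
rewrite -big_split -sumrMnl; apply: eq_bigr => i _ /=.
have ij : (i <= j)%N by rewrite -ltnS.
rewrite !coef_theta ?(leq_trans ij) ?(leq_trans (leq_subr _ _)) //.
by rewrite mulrnAl mulrnAr -mulrnDr subnKC.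
Qed.

Lemma theta1 : theta 1 = 0.
Proof.
have /eqP := thetaM 1 1; rewrite !mulr1 mul1r -subr_eq0 opprD addNKr oppr_eq0.
by move/eqP.
Qed.

Lemma thetaX x k : theta (x ^+ k) = k%:R * x ^+ k.-1 * theta x.
Proof.
case: k => [|k]; first by rewrite theta1 !mul0r.
elim: k => [|k IHk]; first by rewrite mulr1 mul1r.
by rewrite (exprS x k.+1) thetaM IHk /= (exprS x k) -[k.+2%:R]natr1; ring.
Qed.

End Truncation.

(** * Exponential and Todd series over a field, and the substitution u = e^s / a *)

Lemma fps_dilateM (F : fieldType) c (f g : fps F) :
  fps_dilate c (fps_mul f g) =1 fps_mul (fps_dilate c f) (fps_dilate c g).
Proof.
move=> j; rewrite /fps_dilate /fps_mul mulr_sumr; apply: eq_bigr => i _.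
have ij : (i <= j)%N by rewrite -ltnS.
by rewrite -{1}(subnKC ij) exprD mulrACA.
Qed.

Lemma fps_dilate1 (F : fieldType) (c : F) : fps_dilate c (@fps_one F) =1 @fps_one F.
Proof. by move=> [|j]; rewrite /fps_dilate /fps_one ?mul1r ?mulr0. Qed.

Section Exponential.
Variables (F : fieldType) (N : nat).
Hypothesis natF : forall j, (0 < j <= N.+1)%N -> j%:R != 0 :> F.
Local Notation Q := {poly %/ ('X^(N.+1) : {poly F})}.
Local Notation "'s" := (in_qpoly ('X^(N.+1) : {poly F}) 'X).
Local Notation tr := (@fps_trunc F N).

(** Formed inside F directly. Only coefficients whose factorial is nonzero in F are meaningful, the
    inverse of 0 being 0; [exp_pE] and [T_pE] relate these series to the reductions of the rational
    ones. *)
Definition exp_series : fps F := fun j => j`!%:R^-1.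
Definition expm1_series : fps F := fun j => exp_series j.+1.
Definition todd_series : fps F := fps_inv expm1_series.

Local Notation e := exp_series.
Local Notation d := expm1_series.
Local Notation t := todd_series.

Lemma fact_neq0 j : (j <= N.+1)%N -> j`!%:R != 0 :> F.
Proof.
elim: j => [|j IHj] jN; first by rewrite oner_eq0.
by rewrite factS natrM mulf_neq0 ?IHj ?natF // ltnW.
Qed.

Lemma expm1_series0 : d 0%N = 1.
Proof. by rewrite /expm1_series /exp_series factS fact0 muln1 invr1. Qed.

Lemma todd_series0 : t 0%N = 1.
Proof. by rewrite /t /fps_inv expm1_series0 invr1 mul1r big_ord1. Qed.

Lemma todd_mulV : tr d * tr t = 1.
Proof. by rewrite fps_trunc_mulV // expm1_series0 oner_eq0. Qed.

Lemma exp_dilate_expm1 c : tr (fps_dilate c e) = 1 + c *: ('s * tr (fps_dilate c d)).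
Proof.
apply: fps_truncP => j jN; rewrite poly_of_qpolyD coefD coef_qpolyZ coef_qpolyXM //.
rewrite -(fps_trunc1 F N) coef_fps_trunc //.
case: j jN => [|j] jN; first by rewrite /fps_dilate /e invr1 !mulr1 mulr0 addr0.
by rewrite add0r coef_fps_trunc ?(ltnW jN) // /fps_dilate exprS -mulrA.
Qed.

Lemma exp_expm1 : tr e = 1 + 's * tr d.
Proof.
have trdil1 f : tr (fps_dilate 1 f) = tr f.
  by apply: eq_fps_trunc => j _; rewrite /fps_dilate expr1n mul1r.
by rewrite -{1}trdil1 exp_dilate_expm1 trdil1 scale1r.
Qed.

(** With d = (e^s - 1)/s this is s d' = e^s - d; on coefficients, j/(j+1)! = 1/j! - 1/(j+1)!. *)
Lemma theta_expm1 : theta (tr d) = 1 + 's * tr d - tr d.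
Proof.
rewrite -exp_expm1; apply: qpolyP => j jN.
rewrite coef_theta // coefB !coef_fps_trunc // /d /e factS natrM invfM.
rewrite -[LHS]mulr_natl.
apply: (mulfI (natF (_ : 0 < j.+1 <= N.+1)%N)) => //.
have jn0 : j.+1%:R != 0 :> F by apply: natF.
by rewrite mulrBr mulrCA !mulVKf // -[j.+1%:R]natr1 mulrDl mul1r addrK.
Qed.

(** Applying [theta] to d t = 1 gives theta t = - t^2 theta d; then [theta_expm1] and d t = 1
    eliminate d. *)
Lemma theta_todd : theta (tr t) = tr t - tr t ^+ 2 - 's * tr t.
Proof.
have := congr1 (@theta F N) todd_mulV; rewrite thetaM theta1 theta_expm1 => e0.
have dt := todd_mulV.
set x := theta (tr t) in e0 *; set y := 's in e0 *.
have -> : x = (tr d * tr t) * x by rewrite dt mul1r.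
have -> : tr d * tr t * x = tr t * (- (1 + y * tr d - tr d) * tr t).
  by rewrite mulrAC (mulrC _ (tr t)); congr (_ * _); apply/eqP;
     rewrite -subr_eq0 mulNr opprK addrC e0.
have -> : tr t * (- (1 + y * tr d - tr d) * tr t) =
  - tr t ^+ 2 - y * (tr d * tr t) * tr t + (tr d * tr t) * tr t by ring.
by rewrite dt; ring.
Qed.

(** A substitute for a residue computation. By the differential equation, theta (t^(j+1)) = (j+1)
    (t^(j+1) - t^(j+2) - s t^(j+1)). At s^(j+1) the left side is j+1 times the coefficient of
    t^(j+1) and cancels the first term on the right, so the coefficient of t^(j+2) there is minus
    that of t^(j+1) at s^j. *)
Lemma coef_todd_exp j : (j <= N)%N -> (tr t ^+ j.+1)`_j = (-1) ^+ j.
Proof.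
elim: j => [|j IHj] jN.
  by rewrite expr1 coef_fps_trunc // todd_series0.
have /(congr1 (fun x : Q => (x : {poly F})`_j.+1)) := thetaX (tr t) j.+1.
rewrite coef_theta // theta_todd.
have -> : j.+1%:R * tr t ^+ j.+1.-1 * (tr t - tr t ^+ 2 - 's * tr t) =
  j.+1%:R *: (tr t ^+ j.+1 - tr t ^+ j.+2 - 's * tr t ^+ j.+1).
  rewrite scaler_nat -mulr_natl /= (exprS (tr t) j.+1) (exprS (tr t) j); ring.
have jn0 : j.+1%:R != 0 :> F by rewrite natF //= leqW.
rewrite coef_qpolyZ !coefB coef_qpolyXM // IHj ?(ltnW jN) // -[LHS]mulr_natl.
move/(mulfI jn0)/eqP; rewrite -subr_eq0 => /eqP h.
rewrite [RHS]exprS mulN1r; apply/eqP; rewrite -addr_eq0; apply/eqP.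
by rewrite -[RHS]h; ring.
Qed.

(** The binomial theorem divided by j!; the factorials that occur are nonzero in F by
    [fact_neq0]. *)
Lemma exp_dilateD c1 c2 :
  tr (fps_dilate c1 e) * tr (fps_dilate c2 e) = tr (fps_dilate (c1 + c2) e).
Proof.
rewrite -fps_truncM; apply: eq_fps_trunc => j jN.
rewrite /fps_mul /fps_dilate (addrC c1) exprDn mulr_suml; apply: eq_bigr => i _.
have ij : (i <= j)%N by rewrite -ltnS.
have f0 k : (k <= j)%N -> k`!%:R != 0 :> F.
  by move=> kj; apply: fact_neq0; rewrite (leq_trans kj) // leqW.
have := congr1 (fun k => k%:R : F) (bin_fact ij); rewrite !natrM => bf.
have /andP[b0 /andP[i0 ji0]] : [&& 'C(j, i)%:R != 0 :> F, i`!%:R != 0 :> F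
    & (j - i)`!%:R != 0 :> F].
  by rewrite -!negb_or -!mulf_eq0 bf f0.
by rewrite /e -[_ *+ 'C(_, _)]mulr_natl -bf; field; rewrite i0 ji0 b0.
Qed.

Lemma exp_dilate_nat k : tr (fps_dilate k%:R e) = tr e ^+ k.
Proof.
elim: k => [|k IHk].
  by rewrite exp_dilate_expm1 scale0r addr0.
rewrite (exprS (tr e)) -IHk -[k.+1%:R]nat1r -exp_dilateD; congr (_ * _).
by apply: eq_fps_trunc => j _; rewrite /fps_dilate expr1n mul1r.
Qed.

(** Both sides invert t(cs). Writing 1/T(cs) as d(cs) needs no division by c. *)
Lemma inv_dilate_todd c : tr (fps_inv (fps_dilate c t)) = tr (fps_dilate c d).
Proof.
have ti : tr (fps_dilate c t) * tr (fps_inv (fps_dilate c t)) = 1.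
  by rewrite fps_trunc_mulV // /fps_dilate todd_series0 mulr1 oner_eq0.
have dt : tr (fps_dilate c d) * tr (fps_dilate c t) = 1.
  rewrite -fps_truncM -(fps_trunc1 F N); apply: eq_fps_trunc => j _.
  rewrite -fps_dilateM -(fps_dilate1 c) /fps_dilate fps_mulV //.
  by rewrite expm1_series0 unitr1.
by rewrite -[LHS]mul1r -dt -mulrA ti mulr1.
Qed.

Variables (a : F) (a_neq0 : a != 0).

Definition exp_subst (P : {poly F}) : Q :=
  in_qpoly ('X^(N.+1)) (P \Po (a^-1 *: \poly_(j < N.+1) e j)).
Local Notation phi := exp_subst.

Lemma exp_substX : phi 'X = a^-1 *: tr e.
Proof. by rewrite /phi comp_polyX in_qpolyZ. Qed.

Lemma exp_subst1 : phi 1 = 1.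
Proof. by rewrite /phi comp_polyC rmorph1. Qed.

Lemma exp_substM P1 P2 : phi (P1 * P2) = phi P1 * phi P2.
Proof. by rewrite /phi comp_polyM rmorphM. Qed.

Lemma exp_substB P1 P2 : phi (P1 - P2) = phi P1 - phi P2.
Proof. by rewrite /phi comp_polyB rmorphB. Qed.

Lemma exp_substD P1 P2 : phi (P1 + P2) = phi P1 + phi P2.
Proof. by rewrite /phi comp_polyD rmorphD. Qed.

Lemma exp_substZ c P : phi (c *: P) = c *: phi P.
Proof. by rewrite /phi comp_polyZ in_qpolyZ. Qed.

Lemma exp_substXn P k : phi (P ^+ k) = phi P ^+ k.
Proof. by rewrite /phi rmorphXn /= rmorphXn. Qed.

Lemma exp_subst_prod (I : Type) (s : seq I) (P : I -> {poly F}) :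
  phi (\prod_(i <- s) P i) = \prod_(i <- s) phi (P i).
Proof. by rewrite /phi rmorph_prod /= rmorph_prod. Qed.

Lemma exp_subst_linear b : phi (1 - b *: 'X) = 1 - (b / a) *: tr e.
Proof. by rewrite exp_substB exp_subst1 exp_substZ exp_substX scalerA. Qed.

Lemma exp_subst_pole : phi (1 - a *: 'X) = - ('s * tr d).
Proof.
by rewrite exp_subst_linear divff // scale1r exp_expm1 opprD addrA subrr sub0r.
Qed.

Lemma exp_subst0 : phi 0 = 0.
Proof. by rewrite /phi comp_polyC rmorph0. Qed.

Lemma coef_exp_subst (A : {poly F}) : (size A <= N.+1)%N ->
  (tr t ^+ N.+1 * phi A)`_N = (-1) ^+ N * A.[0].
Proof.
(* The polynomial c is A expanded in w = 1 - a u, since u = (1 - w)/a; hence A(0) is c at w = 1, the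
   sum of its coefficients. *)
move=> sA; pose v : {poly F} := a^-1 *: (1 - 'X); pose c := A \Po v.
have sc : (size c <= N.+1)%N.
  rewrite size_comp_poly2 // /v size_scale ?invr_eq0 //.
  by rewrite -opprB size_polyN size_XsubC.
have Ac : A = c \Po (1 - a *: 'X).
  rewrite /c -comp_polyA /v comp_polyZ comp_polyB comp_polyX comp_polyC.
  by rewrite opprB addrC subrK scalerA mulVf // scale1r comp_polyXr.
have A0 : A.[0] = \sum_(k < size c) c`_k.
  rewrite [in LHS]Ac horner_comp !hornerE oppr0 addr0 horner_coef.
  by apply: eq_bigr => k _; rewrite expr1n mulr1.
have phiA : phi A = \sum_(k < size c) c`_k *: (- ('s * tr d)) ^+ k.
  rewrite Ac comp_polyE (big_morph _ exp_substD exp_subst0).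
  by apply: eq_bigr => k _; rewrite exp_substZ exp_substXn exp_subst_pole.
rewrite A0 mulr_sumr phiA [in LHS]mulr_sumr poly_of_qpoly_sum coef_sum.
apply: eq_bigr => k _.
have kN : (k <= N)%N by rewrite -ltnS (leq_trans (ltn_ord k)).
have dt k0 : tr d ^+ k0 * tr t ^+ k0 = 1 by rewrite -exprMn todd_mulV expr1n.
(* Each factor d cancels one t. What remains is the coefficient of t^(N-k+1) at s^(N-k), which is
   (-1)^(N-k); with the sign (-1)^k the result no longer depends on k. *)
have -> : tr t ^+ N.+1 * (c`_k *: (- ('s * tr d)) ^+ k) =
    (c`_k * (-1) ^+ k) *: ('s ^+ k * tr t ^+ (N - k).+1).
  have -> : tr t ^+ N.+1 = tr t ^+ (N - k).+1 * tr t ^+ k.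
    by rewrite -exprD addSn subnK.
  rewrite -scaleN1r exprZn scalerA -scalerAr exprMn; congr (_ *: _).
  by rewrite mulrACA (mulrC (tr t ^+ k)) dt mulr1 mulrC.
rewrite coef_qpolyZ coef_qpolyXnM // ltnNge kN /= coef_todd_exp ?leq_subr //.
by rewrite -mulrA -exprD subnKC // mulrC.
Qed.

(** The substitution is applied to the equation of the block at 1/a. Here [rho b] stands for the
    truncation of R_(b/a), known only through its defining product, and the factors 1 - b/a stay on
    the left so that nothing is divided. *)
Lemma block_expansion (r : nat) (B : seq F) (rho : F -> Q) (A K : {poly F}) :
  (size A <= N.+1)%N -> a ^+ r.+1 = 1 ->
  A * ('X^r * \prod_(b <- B) (1 - b *: 'X)) =
    1 - 'X^(r.+1) + (1 - a *: 'X) ^+ N.+1 * K ->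
  (forall b, rho b * (1 - (b / a) *: tr e) = (1 - b / a)%:A) ->
  (\prod_(b <- B) (1 - b / a)) *: (tr t ^+ N.+1 * phi A) =
  - (r.+1%:R * a ^+ r) *: ('s * (tr (fps_dilate (- r%:R) e) *
     (tr t ^+ N.+1 * tr (fps_inv (fps_dilate r.+1%:R t)) * \prod_(b <- B) rho b))).
Proof.
move=> sA ar eqA rhoE.
have := congr1 phi eqA; rewrite !exp_substM exp_substD exp_substM !exp_substB.
rewrite !exp_substXn !exp_substX exp_subst1 exp_subst_prod exp_subst_pole.
(* The unknown multiple K of the pole factor disappears here. *)
have -> : (- ('s * tr d)) ^+ N.+1 = 0.
  by rewrite exprNn exprMn qpolyXn_eq0 mul0r mulr0.
rewrite mul0r addr0 !exprZn !exprVn ar invr1 scale1r.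
have er : tr e ^+ r * tr (fps_dilate (- r%:R) e) = 1.
  by rewrite -exp_dilate_nat exp_dilateD subrr exp_dilate_expm1 scale0r addr0.
(* With m = r+1, 1 - e^(ms) = - m s d(ms), and d(ms) is 1/T(ms): this supplies both the extra factor
   s and the Todd denominator. *)
rewrite -(exp_dilate_nat r.+1) exp_dilate_expm1 opprD addNKr inv_dilate_todd.
under eq_bigr => b _ do rewrite exp_subst_linear.
set P := \prod_(b <- B) (1 - _ *: _); set R := \prod_(b <- B) rho b => phiA.
have RP : R * P = (\prod_(b <- B) (1 - b / a))%:A.
  rewrite /R /P -big_split (eq_bigr _ (fun b _ => rhoE b)) /=.
  by rewrite -(rmorph_prod (in_alg Q)).
rewrite -[in LHS](mulr1 (_ * _)) scalerAr -RP -[LHS]mulr1 -er.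
(* After inserting e^(rs) e^(-rs) = 1 and R P, the factors are regrouped so that the image of the
   left side of the block equation appears and [phiA] applies. *)
transitivity (a ^+ r *: (tr t ^+ N.+1 * R * tr (fps_dilate (- r%:R) e) *
   (phi A * (a ^- r *: tr e ^+ r * P)))).
  rewrite -scalerAl -!scalerAr scalerA divff ?expf_neq0 // scale1r.
  by ring.
rewrite phiA -scaleNr -scalerAr scalerA mulrN mulrC; congr (_ *: _).
by ring.
Qed.
End Exponential.

(** * Partial fractions with cleared denominators, and the blocks of E_M *)

Section PartialFractions.
Variable F : fieldType.
Implicit Types (q N : {poly F}) (qs : seq {poly F}) (l : {poly F} -> nat).

(** Induction on [qs]: a Bezout relation splits off one prime power, and the degree bound on N
    passes to the remaining numerator. *)
Lemma partial_fractions_poly qs l N :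
  uniq qs -> pairwise (@coprimep F) qs -> {in qs, forall q, q != 0} ->
  (size N < size (\prod_(q <- qs) q ^+ l q)%R)%N ->
  exists2 A : {poly F} -> {poly F},
    {in qs, forall q, (size (A q) <= l q * (size q).-1)%N}
    & N = \sum_(q <- qs) A q * \prod_(q1 <- qs | q1 != q) q1 ^+ l q1.
Proof.
elim: qs N => [|q qs IHqs] N /=.
  rewrite big_nil size_poly1 ltnS leqn0 size_poly_eq0 => _ _ _ /eqP ->.
  by exists (fun=> 0) => //; rewrite big_nil.
move=> /andP[qqs uqs] /andP[/allP coq coqs] nz.
have q0 : q != 0 by rewrite nz ?mem_head.
have nzs : {in qs, forall q1, q1 != 0}.
  by move=> q1 q1s; rewrite nz // inE q1s orbT.
set D := \prod_(q1 <- qs) q1 ^+ l q1.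
have D0 : D != 0.
  by rewrite /D prodf_seq_neq0; apply/allP => q1 q1s; rewrite expf_neq0 ?nzs.
have ql0 : q ^+ l q != 0 by rewrite expf_neq0.
rewrite big_cons -/D => sN.
have /Bezout_eq1_coprimepP[[u v] /= uv] : coprimep (q ^+ l q) D.
  rewrite /D big_seq; elim/big_ind: _; first exact: coprimep1.
    by move=> x y cx cy; rewrite coprimepMr cx.
  by move=> q1 /coq c; rewrite coprimep_expl // coprimep_expr.
(* Since N = N u q^l + N v D, reducing N v modulo q^l gives the block at q; the quotient times D
   moves into B. *)
pose A0 := (N * v) %% q ^+ l q; pose B := N * u + (N * v) %/ q ^+ l q * D.
have eN : N = A0 * D + B * q ^+ l q.
  transitivity (N * (u * q ^+ l q + v * D)); first by rewrite uv mulr1.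
  rewrite mulrDr !mulrA [in LHS](divp_eq (N * v) (q ^+ l q)) -/A0 /B.
  by ring.
have sA0 : (size A0 < size (q ^+ l q)%R)%N by rewrite ltn_modp.
(* Both N and A0 D have smaller degree than q^l D, hence so does B q^l, and q^l can be cancelled
   from the comparison. *)
have sB : (size B < size D)%N.
  have [->|B0] := eqVneq B 0; first by rewrite size_poly0 size_poly_gt0.
  have sq : (0 < size (q ^+ l q)%R)%N by rewrite size_poly_gt0.
  have : (size (B * q ^+ l q)%R < size (q ^+ l q * D)%R)%N.
    have -> : B * q ^+ l q = N - A0 * D by rewrite eN addrC addKr.
    rewrite (leq_ltn_trans (size_polyD _ _)) // gtn_max sN size_polyN.
    rewrite (size_mul ql0 D0) (leq_ltn_trans (size_polyMleq _ _)) //.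
    have := D0; rewrite -size_poly_gt0; case: (size D) => // k _.
    by rewrite !addnS /= ltn_add2r.
  rewrite !size_mul // addnC -!subn1 ltn_subLR ?addn_gt0 ?sq //.
  by rewrite add1n subn1 prednK ?addn_gt0 ?sq // ltn_add2l.
have [A sA eB] := IHqs B uqs coqs nzs sB.
exists (fun x => if x == q then A0 else A x) => [q1|].
  rewrite inE; case: eqVneq => [-> _|_ /= /sA //].
  by move: sA0; rewrite [size (q ^+ l q)%R]polySpred // size_exp mulnC.
have neq : {in qs, forall q1, q1 != q} by move=> q1; apply: contraTneq => ->.
rewrite big_cons eqxx big_cons eqxx /= -big_filter.
rewrite (all_filterP _); last by apply/allP.
rewrite [LHS]eN -/D eB mulr_suml; congr (_ + _).
apply: eq_big_seq => q1 q1s; rewrite (negPf (neq _ q1s)) big_cons eq_sym neq //.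
by rewrite mulrCA mulrC.
Qed.

Lemma pole_factorV (b : F) : pole_factor b^-1 = 1 - b *: 'X.
Proof. by rewrite /pole_factor invrK. Qed.

Lemma pole_factorVE (b : F) : b != 0 ->
  pole_factor b^-1 = - b *: ('X - (b^-1)%:P).
Proof.
move=> b0; rewrite pole_factorV scaleNr scalerBr opprB; congr (_ - _).
by rewrite -mul_polyC -polyCM divff.
Qed.

Lemma size_pole_factorV (b : F) : b != 0 -> size (pole_factor b^-1) = 2.
Proof.
by move=> b0; rewrite pole_factorVE // size_scale ?oppr_eq0 // size_XsubC.
Qed.

Lemma irreducible_pole_factorV (b : F) :
  b != 0 -> irreducible_poly (pole_factor b^-1).
Proof.
move=> b0; split=> [|d sd]; first by rewrite size_pole_factorV.
have nb0 : - b != 0 by rewrite oppr_eq0.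
rewrite pole_factorVE // dvdpZr // (eqp_rtrans (eqp_scale _ nb0)).
exact: (irredp_XsubC b^-1).2.
Qed.

Lemma pole_factorV_inj : injective (fun b : F => pole_factor b^-1).
Proof.
move=> b c; rewrite !pole_factorV => /(congr1 (fun P : {poly F} => P`_1)).
by rewrite !coefB !coefZ coef1 coefX !mulr1 !sub0r => /oppr_inj.
Qed.

Lemma coprimep_pole_factorV (b c : F) :
  b != 0 -> b != c -> coprimep (pole_factor b^-1) (pole_factor c^-1).
Proof.
move=> b0 bc; rewrite pole_factorVE // pole_factorV.
rewrite coprimepZl ?oppr_eq0 // coprimep_sym coprimep_XsubC /root !hornerE.
by rewrite -[X in X - _](mulfV b0) -mulrBl mulf_neq0 ?invr_eq0 // subr_eq0.
Qed.

(* The irreducible factors of the denominator of E_M, with their multiplicities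
   as a function of the factor: the coefficient of 'X in 1 - b *: 'X is - b. *)
Definition E_factors (M : seq F) : seq {poly F} :=
  'X :: [seq pole_factor b^-1 | b <- undup M].

Definition E_mult (r : nat) (M : seq F) (q : {poly F}) : nat :=
  if q == 'X then r else count_mem (- q`_1) M.

Variables (r : nat) (M : seq F).
Hypothesis M0 : {in M, forall b, b != 0}.
Let l := E_mult r M.

Lemma pole_factorV_neqX (b : F) : pole_factor b^-1 != 'X.
Proof.
apply/eqP => /(congr1 (fun P : {poly F} => P`_0)); rewrite pole_factorV.
by rewrite coefB coef1 coefZ !coefX mulr0 subr0 => /eqP; rewrite oner_eq0.
Qed.

Lemma E_multX : l 'X = r.
Proof. by rewrite /l /E_mult eqxx. Qed.

Lemma E_mult_pole b : l (pole_factor b^-1) = count_mem b M.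
Proof.
rewrite /l /E_mult (negPf (pole_factorV_neqX b)) pole_factorV.
by rewrite coefB coef1 coefZ coefX mulr1 sub0r opprK.
Qed.

Lemma prod_pole_factors (P : pred F) :
  \prod_(b <- undup M | P b) pole_factor b^-1 ^+ count_mem b M =
  \prod_(b <- M | P b) (1 - b *: 'X).
Proof.
by rewrite prodr_undup_exp_count; apply: eq_bigr => b _; rewrite pole_factorV.
Qed.

Lemma pole_cofactor a : a \in M ->
  \prod_(q <- E_factors M | q != pole_factor a^-1) q ^+ l q =
  'X^r * \prod_(b <- mset_remove a M) (1 - b *: 'X).
Proof.
move=> aM; rewrite big_cons eq_sym pole_factorV_neqX E_multX big_map big_filter.
rewrite -prod_pole_factors; congr (_ * _).
by apply: eq_big => [b|b _]; rewrite ?(inj_eq pole_factorV_inj) // E_mult_pole.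
Qed.

Lemma pole_cofactorX :
  \prod_(q <- E_factors M | q != 'X) q ^+ l q = \prod_(b <- M) (1 - b *: 'X).
Proof.
rewrite big_cons eqxx big_map -(prod_pole_factors xpredT).
by apply: eq_big => [b|b _]; rewrite ?pole_factorV_neqX ?E_mult_pole.
Qed.

Lemma size_prod_linear : size (\prod_(b <- M) (1 - b *: 'X)%R) = (size M).+1.
Proof.
elim: M M0 => [|b s IHs] s0; first by rewrite big_nil size_poly1.
have b0 : b != 0 by rewrite s0 ?mem_head.
have {}IHs : size (\prod_(b <- s) (1 - b *: 'X)%R) = (size s).+1.
  by apply: IHs => c cs; rewrite s0 // inE cs orbT.
rewrite big_cons -pole_factorV size_mul ?size_pole_factorV ?IHs //.
  by rewrite -size_poly_eq0 size_pole_factorV.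
by rewrite -size_poly_eq0 IHs.
Qed.

Lemma mem_E_factors a : a \in M -> pole_factor a^-1 \in E_factors M.
Proof.
move=> aM; rewrite inE (map_f (fun b => pole_factor b^-1)) ?mem_undup //.
by rewrite orbT.
Qed.

Lemma uniq_E_factors : uniq (E_factors M).
Proof.
rewrite /= map_inj_uniq ?undup_uniq ?andbT; last exact: pole_factorV_inj.
by apply/mapP => -[b _ /eqP]; rewrite eq_sym (negPf (pole_factorV_neqX b)).
Qed.

(** Multiplying numerator and denominator by u^r gives E_M the numerator 1 - u^(r+1). Its degree r+1
    is below r + |M| because |M| > 1, so there is no polynomial part. The second conjunct, free of
    fractions, is what the later computations use. *)
Lemma E_partial_fractions : (1 < size M)%N ->
  exists A : {poly F} -> {poly F},
    partial_fractions (E_fun r M) 0 (E_factors M) l A /\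
    1 - 'X^(r.+1) = \sum_(q <- E_factors M)
                      A q * \prod_(q1 <- E_factors M | q1 != q) q1 ^+ l q1.
Proof.
move=> sM.
have irr : {in E_factors M, forall q, irreducible_poly q}.
  move=> q; rewrite inE => /predU1P[->|/mapP[b]].
    by rewrite -['X]addr0; apply: irredp_XaddC.
  by rewrite mem_undup => /M0 b0 ->; apply: irreducible_pole_factorV.
have co : pairwise (@coprimep F) (E_factors M).
  rewrite /= pairwise_map; apply/andP; split.
    apply/allP => _ /mapP[b _ ->]; rewrite pole_factorV coprimep_sym.
    rewrite -['X as X in coprimep _ X]subr0 coprimep_XsubC /root !hornerE.
    by rewrite oppr0 addr0 oner_eq0.
  have := undup_uniq M; rewrite uniq_pairwise.
  apply: (@sub_in_pairwise _ (mem M)) => [b c /M0 b0 _ /=|].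
    exact: coprimep_pole_factorV.
  by apply/allP => b; rewrite mem_undup.
have nz : {in E_factors M, forall q, q != 0}.
  by move=> q /irr[]; rewrite -size_poly_gt0; case: size.
have eprod : \prod_(q <- E_factors M) q ^+ l q =
    'X^r * \prod_(b <- M) (1 - b *: 'X).
  rewrite big_cons E_multX big_map -(prod_pole_factors xpredT); congr (_ * _).
  by apply: eq_bigr => b _; rewrite E_mult_pole.
have [] := partial_fractions_poly (l := l) (N := 1 - 'X^(r.+1)) uniq_E_factors co nz.
  rewrite eprod mulrC size_mulXn; last first.
    by rewrite -size_poly_eq0 size_prod_linear.
  rewrite size_prod_linear // (leq_ltn_trans (size_polyD _ _)) //.
  rewrite size_poly1 size_polyN size_polyXn gtn_max !addnS !ltnS.
  by rewrite (leq_trans (ltnW sM) (leq_addl _ _)) -addn2 leq_add2l.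
move=> A sA eA; exists A; split => //; split => //.
have prod0 : \prod_(q <- E_factors M) q ^+ l q != 0.
  by rewrite prodf_seq_neq0; apply/allP => q qs; rewrite expf_neq0 ?nz.
have qF0 q : q \in E_factors M -> (q ^+ l q)%:F != 0.
  by move=> /nz q0; rewrite tofrac_eq0 expf_neq0.
rewrite tofrac0 add0r.
transitivity ((1 - 'X^(r.+1))%:F / (\prod_(q <- E_factors M) q ^+ l q)%:F).
  rewrite eprod /E_fun tofracM invfM rmorphB rmorph1 !rmorphXn /= mulrA.
  congr (_ / _).
    by rewrite mulrBl mul1r exprS mulfK // expf_neq0 // tofrac_eq0 polyX_eq0.
  rewrite rmorph_prod; apply: eq_bigr => b _.
  by rewrite rmorphB rmorph1 -mul_polyC rmorphM.
rewrite eA rmorph_sum /= mulr_suml; apply: eq_big_seq => q qs.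
have -> : \prod_(q1 <- E_factors M) q1 ^+ l q1 =
    q ^+ l q * \prod_(q1 <- E_factors M | q1 != q) q1 ^+ l q1.
  by rewrite (bigD1_seq q) ?uniq_E_factors.
rewrite !tofracM -mulf_div divff ?mulr1 // tofrac_eq0 prodf_seq_neq0.
by apply/allP => x /nz x0; rewrite expf_neq0 ?implybT.
Qed.

Variable A : {poly F} -> {poly F}.
Hypothesis eA : 1 - 'X^(r.+1) = \sum_(q <- E_factors M)
  A q * \prod_(q1 <- E_factors M | q1 != q) q1 ^+ l q1.

(** In the cleared identity every term other than that of the pole 1/a contains the full power of
    its pole factor; K collects these terms. *)
Lemma block_equation a : a \in M -> exists K,
  A (pole_factor a^-1) *
    ('X^r * \prod_(b <- mset_remove a M) (1 - b *: 'X)) =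
  1 - 'X^(r.+1) + (1 - a *: 'X) ^+ count_mem a M * K.
Proof.
move=> aM; set qa := pole_factor a^-1.
have qaM : qa \in E_factors M := mem_E_factors aM.
suff [K eK] : exists K, \sum_(q <- E_factors M | q != qa)
    A q * \prod_(q1 <- E_factors M | q1 != q) q1 ^+ l q1 = qa ^+ l qa * K.
  exists (- K); rewrite eA (bigD1_seq qa) ?uniq_E_factors //= eK pole_cofactor //.
  by rewrite -pole_factorV -E_mult_pole mulrN addrK.
elim/big_ind: _; first by exists 0; rewrite mulr0.
  by move=> _ _ [K1 ->] [K2 ->]; exists (K1 + K2); rewrite mulrDr.
move=> q qqa; rewrite (big_rem qa) //= eq_sym qqa mulrCA.
by eexists; congr (_ * _).
Qed.

End PartialFractions.

(** * h_r(M) as a coefficient, and as a sum of values of blocks *)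

Lemma hsym_coef (F : fieldType) (n r : nat) (M : n.-tuple F) :
  hsym r M = (\prod_(b <- M) \sum_(j < r.+1) (b *: 'X) ^+ j)`_r.
Proof.
rewrite big_tuple bigA_distr_bigA coef_sum /hsym big_mkcond; apply: eq_bigr.
move=> alpha _.
have -> : \prod_(i < n) (tnth M i *: 'X) ^+ alpha i =
    (\prod_(i < n) tnth M i ^+ alpha i) *: 'X^(\sum_(i < n) alpha i).
  rewrite -prodrXr -scaler_prod; apply: eq_bigr => i _.
  by rewrite exprZn.
by rewrite coefZ coefXn eq_sym; case: eqP; rewrite ?mulr1 ?mulr0.
Qed.

Lemma hsym_blocks (F : fieldType) (n r : nat) (M : n.-tuple F)
    (A : {poly F} -> {poly F}) :
  (size (A 'X) <= r)%N ->
  1 - 'X^(r.+1) = \sum_(q <- E_factors M)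
    A q * \prod_(q1 <- E_factors M | q1 != q) q1 ^+ E_mult r M q1 ->
  hsym r M = \sum_(a <- undup M) (A (pole_factor a^-1)).[0].
Proof.
(* H is a polynomial inverse of the product of the 1 - b u modulo u^(r+1); it replaces the Laurent
   expansion at 0. *)
move=> sA eA; pose H := \prod_(b <- M) \sum_(j < r.+1) (b *: 'X) ^+ j.
have HD : exists K, H * \prod_(b <- M) (1 - b *: 'X) = 1 + 'X^(r.+1) * K.
  rewrite -big_split /=; elim/big_ind: _; first by exists 0; rewrite mulr0 addr0.
    move=> _ _ [K1 ->] [K2 ->]; exists (K1 + K2 + K1 * ('X^(r.+1) * K2)).
    by ring.
  move=> b _; exists (- (b ^+ r.+1)%:P).
  rewrite mulrC -opprB mulNr -subrX1 exprZn opprB mulrN mulrC mul_polyC.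
  by [].
have H0 : H.[0] = 1.
  rewrite horner_prod big1 // => b _; rewrite horner_sum big_ord_recl.
  rewrite !hornerE big1 ?addr0 // => i _.
  by rewrite horner_exp !hornerE expr0n.
have [K HDK] := HD.
have := congr1 (fun P : {poly F} => (P * H)`_r) eA.
(* The cleared identity times H is compared at u^r. The left side gives h_r(M); the block at 0 gives
   the coefficient of [A 'X] at r, which is 0 by its size; every other block carries u^r and gives
   its value at 0. *)
rewrite mulrBl mul1r coefB coefXnM ltnSn subr0 -hsym_coef => ->.
rewrite big_cons mulrDl coefD pole_cofactorX -mulrA (mulrC _ H) HDK mulrDr mulr1.
rewrite coefD mulrCA coefXnM ltnSn addr0 nth_default // add0r.
rewrite big_map mulr_suml coef_sum; apply: eq_big_seq => a.
rewrite mem_undup => aM; rewrite pole_cofactor // mulrCA -mulrA coefXnM ltnn subnn.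
rewrite -horner_coef0 !hornerM H0 mulr1 horner_prod big1 ?mulr1 // => b _.
by rewrite !hornerE oppr0 addr0.
Qed.

(** * Reduction of rational coefficients into a field *)

Section Reduction.
Variable F : fieldType.
Implicit Types (x : rat) (y : F).

(* Unlike [ratr], whose values are junk when the denominator vanishes in F, this
   relation is compatible with the ring operations. *)
Definition reduces x y : Prop := exists u v : int,
  [/\ v%:~R != 0 :> F, x = u%:~R / v%:~R & y = u%:~R / v%:~R].

(** The reduced denominator of x divides every v with x = u/v, so it is nonzero in F once one such v
    is. *)
Lemma reduces_denom x y :
  reduces x y -> (denq x)%:~R != 0 :> F /\ ratr x = y.
Proof.
move=> [u [v [v0 ex ey]]].
have vn0 : v != 0 by apply: contraNneq v0 => ->.
have euv : (u * denq x = numq x * v)%R.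
  apply: (@intr_inj rat); rewrite !rmorphM /=.
  have vq : v%:~R != 0 :> rat by rewrite intr_eq0.
  have dq : (denq x)%:~R != 0 :> rat by rewrite intr_eq0 denq_neq0.
  have := divq_num_den x; rewrite [in RHS]ex => /eqP.
  rewrite (eqr_div _ _ dq vq) => /eqP h. exact: esym h.
have dv : (denq x %| v)%Z.
  have : (denq x %| numq x * v)%Z by rewrite -euv dvdz_mull.
  by rewrite Gauss_dvdzr // coprimez_sym coprimezE coprime_num_den.
have d0 : (denq x)%:~R != 0 :> F.
  have /dvdzP[w ew] := dv.
  by apply: contraNneq v0 => e0; rewrite ew rmorphM /= e0 mulr0.
split=> //; rewrite /ratr ey; apply/eqP; rewrite eqr_div //.
by rewrite -!rmorphM /= euv.
Qed.

Lemma reduces_int (z : int) : reduces z%:~R z%:~R.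
Proof. by exists z, 1; rewrite !divr1 oner_eq0. Qed.

Lemma reduces_natV k : k%:R != 0 :> F -> reduces k%:R^-1 k%:R^-1.
Proof. by move=> k0; exists 1, k%:Z; rewrite !div1r. Qed.

Lemma reducesD x1 y1 x2 y2 :
  reduces x1 y1 -> reduces x2 y2 -> reduces (x1 + x2) (y1 + y2).
Proof.
move=> [u1 [v1 [n1 -> ->]]] [u2 [v2 [n2 -> ->]]].
have q0 v : v%:~R != 0 :> F -> v%:~R != 0 :> rat.
  by move=> v0; rewrite intr_eq0; apply: contraNneq v0 => ->.
exists (u1 * v2 + u2 * v1), (v1 * v2).
by rewrite !addf_div ?q0 // rmorphM /= mulf_neq0 // !rmorphD /= !rmorphM.
Qed.

Lemma reducesM x1 y1 x2 y2 :
  reduces x1 y1 -> reduces x2 y2 -> reduces (x1 * x2) (y1 * y2).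
Proof.
move=> [u1 [v1 [n1 -> ->]]] [u2 [v2 [n2 -> ->]]].
by exists (u1 * u2), (v1 * v2); rewrite !mulf_div !rmorphM /= mulf_neq0.
Qed.

Lemma reduces0 : reduces 0 0. Proof. exact: (reduces_int 0). Qed.
Lemma reduces1 : reduces 1 1. Proof. exact: (reduces_int 1). Qed.

Lemma reduces_sum (I : Type) (s : seq I) (P : pred I) (f : I -> rat) (g : I -> F) :
  (forall i, P i -> reduces (f i) (g i)) ->
  reduces (\sum_(i <- s | P i) f i) (\sum_(i <- s | P i) g i).
Proof.
by move=> fg; apply: (big_ind2 reduces) => //; [exact: reduces0|exact: reducesD].
Qed.

Definition reduces_below (N : nat) (f : fps rat) (g : fps F) : Prop :=
  forall j, (j < N)%N -> reduces (f j) (g j).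

Lemma reduces_below_one N : reduces_below N (@fps_one _) (@fps_one _).
Proof. by move=> j _; exact: (reduces_int (j == 0%N)). Qed.

Lemma reduces_below_mul N f1 g1 f2 g2 :
  reduces_below N f1 g1 -> reduces_below N f2 g2 ->
  reduces_below N (fps_mul f1 f2) (fps_mul g1 g2).
Proof.
move=> h1 h2 j jN; apply: reduces_sum => i _; apply: reducesM.
  by apply: h1; apply: leq_ltn_trans jN; rewrite -ltnS.
by apply: h2; apply: leq_ltn_trans jN; rewrite leq_subr.
Qed.

Lemma reduces_below_exp N f g k :
  reduces_below N f g -> reduces_below N (fps_exp f k) (fps_exp g k).
Proof.
move=> fg; elim: k => [|k IHk]; first exact: reduces_below_one.
exact: reduces_below_mul.
Qed.

Lemma reducesXn x y k : reduces x y -> reduces (x ^+ k) (y ^+ k).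
Proof.
move=> xy; elim: k => [|k IHk]; first exact: reduces1.
by rewrite !exprS; apply: reducesM.
Qed.

Lemma reduces_below_dilate N x y f g : reduces x y ->
  reduces_below N f g -> reduces_below N (fps_dilate x f) (fps_dilate y g).
Proof.
by move=> xy fg j jN; apply: reducesM; [apply: reducesXn | apply: fg].
Qed.

(** With constant term 1 the coefficients of the inverse are integer polynomials in those of the
    series. *)
Lemma reduces_below_inv N f g : f 0%N = 1 -> g 0%N = 1 ->
  reduces_below N f g -> reduces_below N (fps_inv f) (fps_inv g).
Proof.
move=> f0 g0 fg j jN; rewrite /fps_inv f0 g0 !invr1 !mul1r.
apply: reduces_sum => k _.
suff /(_ j jN) : reduces_below N
    (fps_exp (fun i => fps_one rat i - 1 * f i) k)
    (fps_exp (fun i => fps_one F i - 1 * g i) k) by [].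
apply: reduces_below_exp => i iN; rewrite !mul1r -(mulN1r (f i)) -(mulN1r (g i)).
apply: reducesD; first exact: (@reduces_below_one N).
by apply: reducesM; [exact: (reduces_int (-1)) | apply: fg].
Qed.

Variable N : nat.
Hypothesis natF : forall j, (0 < j <= N)%N -> j%:R != 0 :> F.

Lemma reduces_exp : reduces_below N.+1 exp_rat (exp_series F).
Proof.
move=> j jN; apply: reduces_natV.
elim: j jN => [|j IHj] jN; first by rewrite oner_eq0.
by rewrite factS natrM mulf_neq0 ?IHj ?natF // ltnW.
Qed.

(** One order less than for e^s: the coefficient of T at s^j involves 1/(j+1)!. *)
Lemma reduces_todd : reduces_below N T_rat (todd_series F).
Proof.
apply: reduces_below_inv.
- by rewrite /exp_rat factS fact0 muln1 invr1.
- exact: expm1_series0.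
- by move=> j jN; apply: reduces_exp.
Qed.

End Reduction.

Lemma natr_Fp_neq0 (p j : nat) : prime p -> (0 < j < p)%N -> j%:R != 0 :> 'F_p.
Proof.
move=> pp /andP[j0 jp]; rewrite -(dvdn_pcharf (pchar_Fp pp)).
by rewrite gtnNdvd.
Qed.

Lemma natr_Fp_leq_pred (p : nat) : prime p ->
  forall j, (0 < j <= p.-1)%N -> j%:R != 0 :> 'F_p.
Proof.
move=> pp j /andP[j0 jp].
by rewrite natr_Fp_neq0 // j0 -(prednK (prime_gt0 pp)).
Qed.

Lemma exp_pE (p j : nat) : prime p -> (j < p)%N -> exp_p p j = exp_series 'F_p j.
Proof.
move=> pp jp; apply: (reduces_denom _).2.
by apply: (reduces_exp (natr_Fp_leq_pred pp)); rewrite prednK ?prime_gt0.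
Qed.

Lemma T_pE (p j : nat) : prime p -> (j < p.-1)%N -> T_p p j = todd_series 'F_p j.
Proof.
move=> pp jp; apply: (reduces_denom _).2.
exact: (reduces_todd (natr_Fp_leq_pred pp)).
Qed.

(** * The block at 1/a over F_p *)

Section Block.
Variables (p r : nat) (M : seq 'F_p) (a : 'F_p).
Hypotheses (pp : prime p) (sM : (size M < p)%N) (aM : a \in M).
Hypotheses (ar : a ^+ r.+1 = 1).
Local Notation mu := (count_mem a M).
Local Notation N := (count_mem a M).-1.
Local Notation tr := (@fps_trunc 'F_p N).
Local Notation e := (exp_series 'F_p).
Local Notation t := (todd_series 'F_p).

Let a_neq0 : a != 0.
Proof.
by apply: contra_eq_neq ar => ->; rewrite expr0n eq_sym oner_eq0.
Qed.

Lemma one_sub_ratio_neq0 b : b \in mset_remove a M -> 1 - b / a != 0.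
Proof.
rewrite mem_filter => /andP[ba _]; rewrite -[X in X - _](divff a_neq0) -mulrBl.
by rewrite mulf_neq0 ?invr_eq0 ?a_neq0 // subr_eq0 eq_sym.
Qed.

(** Series are cut modulo s^mu, one order beyond what F_a requires, because F_a occurs multiplied by
    s. *)
Let muE : N.+1 = mu.
Proof. by rewrite prednK // -has_count has_pred1. Qed.

Let mu_lt_p : (mu < p)%N.
Proof. exact: leq_ltn_trans (count_size _ _) sM. Qed.

Let leN_lt_pred j : (j <= N)%N -> (j < p.-1)%N.
Proof.
by move=> jN; rewrite (leq_ltn_trans jN) // -ltnS muE prednK ?prime_gt0.
Qed.

Let leN_ltp j : (j <= N)%N -> (j < p)%N.
Proof. by move/leN_lt_pred => jp; rewrite (leq_trans jp) ?leq_pred. Qed.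

Let natF_block j : (0 < j <= N.+1)%N -> j%:R != 0 :> 'F_p.
Proof.
rewrite muE => /andP[j0 jmu].
by rewrite natr_Fp_neq0 // j0 (leq_ltn_trans jmu mu_lt_p).
Qed.

Lemma fps_trunc_exp_p c : tr (fps_dilate c (exp_p p)) = tr (fps_dilate c e).
Proof. by apply: eq_fps_trunc => j /leN_ltp jp; rewrite /fps_dilate exp_pE. Qed.

Lemma fps_trunc_R_series c : tr (R_series c) * (1 - c *: tr e) = (1 - c)%:A.
Proof.
(* At c = 1 the prefactor 1 - c makes both sides 0, so the identity holds for all c, as
   [block_expansion] asks. *)
have [->|c1] := eqVneq c 1.
  by rewrite /R_series fps_truncZ subrr !scale0r mul0r.
pose g : fps 'F_p := fun j => fps_one 'F_p j - c * exp_p p j.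
have g0 : g 0%N = 1 - c.
  by rewrite /g exp_pE ?prime_gt0 // /exp_series fact0 invr1 mulr1.
have -> : 1 - c *: tr e = tr g.
  apply/esym/fps_truncP => j jN; rewrite coefB coef_qpolyZ coef_fps_trunc //.
  by rewrite -(fps_trunc1 _ N) coef_fps_trunc // /g exp_pE ?leN_ltp.
rewrite /R_series fps_truncZ -scalerAl mulrC fps_trunc_mulV //.
by rewrite g0 subr_eq0 eq_sym.
Qed.

Lemma fps_trunc_dilate_T_p c : tr (fps_dilate c (T_p p)) = tr (fps_dilate c t).
Proof.
by apply: eq_fps_trunc => j /leN_lt_pred jp; rewrite /fps_dilate T_pE.
Qed.

Lemma fps_trunc_F_series : tr (F_series r M a) =
  tr (fps_dilate (- r%:R) e) *
  (tr t ^+ N.+1 * tr (fps_inv (fps_dilate r.+1%:R t)) *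
   \prod_(b <- mset_remove a M) tr (R_series (b / a))).
Proof.
rewrite /F_series !fps_truncM fps_trunc_prod fps_truncX fps_trunc_exp_p -muE.
have -> : tr (T_p p) = tr (todd_series 'F_p).
  by apply: eq_fps_trunc => j /leN_lt_pred jp; rewrite T_pE.
suff -> : tr (fps_inv (fps_dilate r.+1%:R (T_p p))) =
  tr (fps_inv (fps_dilate r.+1%:R (todd_series 'F_p))) by [].
apply: eq_fps_trunc_inv; last exact: fps_trunc_dilate_T_p.
  by rewrite /fps_dilate T_pE ?leN_lt_pred // todd_series0 mulr1 oner_eq0.
by rewrite /fps_dilate todd_series0 mulr1 oner_eq0.
Qed.

(* For mu = 1, where E_M is regular at 1/a, the block is 0. *)
Lemma block_value (A K : {poly 'F_p}) : (size A <= mu)%N ->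
  A * ('X^r * \prod_(b <- mset_remove a M) (1 - b *: 'X)) =
    1 - 'X^(r.+1) + (1 - a *: 'X) ^+ mu * K ->
  A.[0] = if (2 <= mu)%N then C_coef r M a * F_series r M a (mu - 2)%N else 0.
Proof.
rewrite -{1 2}muE => sA eA.
have P0 : \prod_(b <- mset_remove a M) (1 - b / a) != 0.
  by rewrite prodf_seq_neq0; apply/allP => b /one_sub_ratio_neq0.
have := block_expansion natF_block a_neq0 sA ar eA
  (fun b => fps_trunc_R_series (b / a)).
rewrite -fps_trunc_F_series => /(congr1 (fun x : {poly %/ _} => (x : {poly _})`_N)).
rewrite !coef_qpolyZ coef_exp_subst ?a_neq0 //.
rewrite coef_qpolyXM //.
(* This turns the factor m a^r of the expansion into the m/a of C_a. *)
have arV : a ^+ r = a^-1.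
  by apply: (mulfI a_neq0); rewrite -exprS ar divff ?a_neq0.
have sgnN : (-1) ^+ mu = - (-1) ^+ N :> 'F_p by rewrite -[in LHS]muE exprS mulN1r.
rewrite /C_coef sgnN prodfV; set P := \prod_(b <- _) _ in P0 *.
have s0 : (-1) ^+ N != 0 :> 'F_p by rewrite signr_eq0.
(* If mu = 1 the coefficient of s F_a at s^0 is 0; otherwise its coefficient at s^(mu-1) is that of
   F_a at s^(mu-2). *)
have := muE; set k := N in s0 *; case: k s0 => [|k] s0 muk.
  by rewrite -muk mulr0 => /eqP; rewrite !mulf_eq0 (negPf P0) (negPf s0) => /eqP.
rewrite coef_fps_trunc ?leqnSn // -muk /= subSS subn1 /= arV => h.
apply: (mulfI s0); apply: (mulfI P0); rewrite h.
have ss : (-1) ^+ k.+1 * (-1) ^+ k.+1 = 1 :> 'F_p by rewrite -expr2 sqrr_sign.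
transitivity (- ((P / P) * ((-1) ^+ k.+1 * (-1) ^+ k.+1)) *
  (r.+1%:R / a * F_series r M a k)); last by ring.
by rewrite ss divff //; ring.
Qed.

Lemma F_series_well_defined : F_well_defined r M a.
Proof.
have natF := natr_Fp_leq_pred pp.
have denom N f g : reduces_below N f (g : fps 'F_p) -> invertible_denoms_below p N f.
  by move=> fg j /fg /reduces_denom[]; rewrite /invertible_denom unitfE.
have Np : (N <= p.-1)%N := ltnW (leN_lt_pred (leqnn N)).
have eR : reduces_below N exp_rat (exp_series 'F_p).
  by move=> j jN; apply: (reduces_exp natF); rewrite ltnS ltnW ?(leq_trans jN).
have tR : reduces_below N T_rat (todd_series 'F_p).
  by move=> j jN; apply: (reduces_todd natF); rewrite (leq_trans jN).
have dR : reduces_below N (fps_dilate r.+1%:R T_rat)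
    (fps_dilate r.+1%:R (todd_series 'F_p)).
  by apply: reduces_below_dilate => //; apply: (reduces_int _ r.+1).
split.
- by split; apply: denom; [exact: eR | exact: tR].
- apply: denom; apply: reduces_below_dilate eR.
  by have := reduces_int 'F_p (- r%:Z); rewrite !rmorphN; apply.
- by apply: denom; apply: reduces_below_exp tR.
- split; apply: denom; first exact: dR.
  apply: reduces_below_inv dR; rewrite /fps_dilate ?todd_series0 ?mulr1 //.
  by rewrite mul1r /T_rat /fps_inv /exp_rat factS fact0 muln1 invr1 mul1r big_ord1.
- by move=> b /one_sub_ratio_neq0; rewrite unitfE.
Qed.
End Block.

(** * Assembly of the local values into the formula for h_r(M) *)

Theorem proposition2p7 (n r p : nat) (M : n.-tuple 'F_p)
    (hn : (3 <= n)%N) (hp : prime p) (hnp : (n < p)%N) (hm : (r.+1 %| p.-1)%N)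
    (hM : forall a, a \in M -> a ^+ r.+1 = 1) :
  [/\ forall a, a \in M -> (2 <= count_mem a M)%N ->
        CT a^-1 (E_fun r M) =
        C_coef r M a * F_series r M a (count_mem a M - 2)%N,
      hsym r M =
        \sum_(a <- undup M | (2 <= count_mem a M)%N)
          C_coef r M a * F_series r M a (count_mem a M - 2)%N
    & forall a, a \in M -> (2 <= count_mem a M)%N -> F_well_defined r M a].
Proof.
have sM : (size M < p)%N by rewrite size_tuple.
have M0 : {in M, forall b, b != 0}.
  by move=> b /hM; apply: contra_eq_neq => ->; rewrite expr0n eq_sym oner_eq0.
have [|A [pfA eA]] := E_partial_fractions r M0.
  by rewrite size_tuple ltnW.
have sA := let: And4 _ _ h _ := pfA in h.
have value a : a \in M -> (A (pole_factor a^-1)).[0] =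
    if (2 <= count_mem a M)%N then
      C_coef r M a * F_series r M a (count_mem a M - 2)%N else 0.
  move=> aM; have [K eK] := block_equation eA aM.
  apply: block_value eK => //; first exact: hM.
  have := sA _ (mem_E_factors aM).
  by rewrite E_mult_pole size_pole_factorV ?M0 // muln1.
split=> [a aM mu2||a aM _].
- rewrite (CT_block _ pfA (mem_E_factors aM)) ?invr_eq0 ?M0 //.
  by rewrite value // mu2.
- rewrite (hsym_blocks _ eA).
    (* The sum over the whole support reduces to mu >= 2, since [value] gives 0 for simple
       entries. *)
    rewrite [RHS]big_mkcond; apply: eq_big_seq => a.
    by rewrite mem_undup => /value.
  have := sA 'X (mem_head _ _).
  by rewrite E_multX size_polyX muln1.
- exact: F_series_well_defined (hM a aM).
Qed.
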